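(* Let $U$ be a supertropical semiring, $x\in\mathcal T(U)$ and $a:=ex$. The following are equivalent. (i) $[x]_{\mathrm{Sis}(x)}$ is ghost in $U/\mathrm{Sis}(x)$. (ii) There exist a son $z$ of $x$ and an elementary $\mathrm{Is}(z)$-path $(vz,u,wz)$ from a son $uvz$ of $z$ over $a$ to $a$. (iii) There exist $u,v,w,p\in U$ with $epx=evpx=ewpx$, $euvpx=a$, $uvpx\in\mathcal T(U)$, $wpx\in\mathcal T(U)$, $uwpx=a$.
   Context: A supertropical semiring is a commutative semiring $U$ such that $e:=1+1$ is idempotent ($e+e=e$) and, for all $a,b\in U$, $a+b\in\{a,b\}$ if $ea\ne eb$, and $a+b=ea$ if $ea=eb$. (Then $ea=0\Rightarrow a=0$.) $M:=eU$ is the set of ghosts and $\mathcal T(U):=U\setminus eU$ the set of tangible elements. An MFCE-relation on $U$ is an equivalence relation $E$ with $x\sim_Ey\Rightarrow xz\sim_Eyz$ for all $z\in U$, and $x\sim_Ey\Rightarrow ex=ey$. In $U/E$ the ghosts are the classes $[a]_E$, $a\in M$ (identified with $M$); the other classes are tangible. MFCE-relations form a complete lattice under inclusion (finer $\subset$ coarser), with joins $\bigvee$. For $x\in\mathcal T(U)$, the sons of $x$ are the elements of $\mathrm S(x):=Ux\cap\mathcal T(U)$; the sons of $x$ over $c\in M$ are the elements of $\mathrm S_c(x):=\{z\in\mathrm S(x)\mid ez=c\}$. For $z\in\mathcal T(U)$, $\mathrm{Is}(z)$ is the finest MFCE-relation $E$ on $U$ such that $s\sim_Et$ for all $s,t\in\mathrm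 S_{ez}(z)$. For $x\in\mathcal T(U)$, $\mathrm{Sis}(x):=\bigvee_{z\in\mathrm S(x)}\mathrm{Is}(z)$. An elementary $\mathrm{Is}(z)$-path is a triple $(s,u,t)$ with $u\in U$ and $s,t\in\mathrm S_{ez}(z)$; it runs from $us$ to $ut$. (Thus for $(vz,u,wz)$: $vz,wz\in\mathcal T(U)$ and $evz=ewz=ez$.) *)

(* Defs.v *)
From Stdlib Require Import RelationClasses.
From mathcomp Require Import all_boot all_algebra.
From mathcomp Require Import boolp classical_sets.

Set Implicit Arguments.
Unset Strict Implicit.
Unset Printing Implicit Defensive.

Import GRing.Theory.
Local Open Scope classical_set_scope.
Local Open Scope ring_scope.

(* [comPzSemiRingType] does not require 1 != 0; the zero semiring has no
   tangible elements. *)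

Definition ghost_one (U : comPzSemiRingType) : U := 1 + 1.
Arguments ghost_one {U}.
Notation "'\e'" := (@ghost_one _) (at level 0) : ring_scope.

Record supertropical (U : comPzSemiRingType) : Prop := Supertropical {
  supertropical_idem : \e + \e = \e :> U;
  supertropical_bipotent : forall a b : U,
    \e * a <> \e * b -> a + b = a \/ a + b = b;
  supertropical_ghost : forall a b : U, \e * a = \e * b -> a + b = \e * a
}.

Section Supertropical.
Variable U : comPzSemiRingType.
Implicit Types (x y z s t a c : U) (E : U -> U -> Prop).

Definition ghosts : set U := [set \e * u | u in [set: U]].
Definition tangibles : set U := ~` ghosts.

Record mfce E : Prop := Mfce {
  mfce_equiv : Equivalence E;
  mfce_mul : forall x y z, E x y -> E (x * z) (y * z);
  mfce_fiber : forall x y, E x y -> \e * x = \e * y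
}.

Definition finer E E' : Prop := forall x y, E x y -> E' x y.

Definition rel_meet (F : set (U -> U -> Prop)) : U -> U -> Prop :=
  fun x y => forall E, F E -> E x y.

(* The join in the lattice of MFCE-relations: the meet of all MFCE-relations
   that are coarser than every member of the family. *)
Definition mfce_join (F : set (U -> U -> Prop)) : U -> U -> Prop :=
  rel_meet [set E | mfce E /\ forall E', F E' -> finer E' E].

Definition eqclass E x : set U := [set y | E x y].

(* [C] ranges over the elements of U/E, which are subsets of [U]. *)
Definition ghost_class E (C : set U) : Prop :=
  exists2 a, ghosts a & C = eqclass E a.

Definition sons x : set U := [set u * x | u in [set: U]] `&` tangibles.
Definition sons_over c x : set U := [set z | sons x z /\ \e * z = c].

Definition identifies_sons z E : Prop :=
  forall s t, sons_over (\e * z) z s -> sons_over (\e * z) z t -> E s t.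

(* That this meet is itself an MFCE-relation identifying the sons of [z] over
   [e z], hence the finest one, is [Is_mfce] and [Is_finest]. *)
Definition Is z : U -> U -> Prop :=
  rel_meet [set E | mfce E /\ identifies_sons z E].

Definition Sis x : U -> U -> Prop := mfce_join [set Is z | z in sons x].

Record path_triple := PathTriple { path_l : U; path_mul : U; path_r : U }.

Definition elementary_Is_path z (q : path_triple) : Prop :=
  sons_over (\e * z) z (path_l q) /\ sons_over (\e * z) z (path_r q).

Definition runs_from_to (q : path_triple) (y y' : U) : Prop :=
  y = path_mul q * path_l q /\ y' = path_mul q * path_r q.

Definition same_ghost x y : Prop := \e * x = \e * y.

Lemma same_ghost_mfce : mfce same_ghost.
Proof.
split=> [|x y z|x y //].
  by split=> [x|x y|x y z]; rewrite /same_ghost // => -> .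
by rewrite /same_ghost !mulrA => ->.
Qed.

Lemma rel_meet_mfce (F : set (U -> U -> Prop)) :
  (exists E, F E) -> (forall E, F E -> mfce E) -> mfce (rel_meet F).
Proof.
move=> [E0 FE0] mF; split=> [|x y z xy E FE|x y xy]; last first.
- exact: (mfce_fiber (mF _ FE0)) (xy _ FE0).
- exact: (mfce_mul (mF _ FE)) (xy _ FE).
split=> [x E FE|x y xy E FE|x y z xy yz E FE]; have [eqE _ _] := mF _ FE.
- exact: reflexivity.
- by symmetry; exact: xy.
- by transitivity y; [exact: xy|exact: yz].
Qed.

Lemma mfce_join_mfce (F : set (U -> U -> Prop)) :
  (forall E, F E -> mfce E) -> mfce (mfce_join F).
Proof.
move=> mF; apply: rel_meet_mfce => [|E []//].
exists same_ghost; split; first exact: same_ghost_mfce.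
by move=> E FE x y; exact: (mfce_fiber (mF _ FE)).
Qed.

Lemma mfce_join_ub (F : set (U -> U -> Prop)) E :
  F E -> finer E (mfce_join F).
Proof. by move=> FE x y xy E1 [_ ub]; exact: ub FE _ _ xy. Qed.

Lemma mfce_join_least (F : set (U -> U -> Prop)) E :
  mfce E -> (forall E', F E' -> finer E' E) -> finer (mfce_join F) E.
Proof. by move=> mE FE x y xy; exact: xy. Qed.

Lemma Is_mfce z : mfce (Is z).
Proof.
apply: rel_meet_mfce => [|E []//].
exists same_ghost; split; first exact: same_ghost_mfce.
by move=> s t [_ es] [_ et]; rewrite /same_ghost es et.
Qed.

Lemma Is_identifies z : identifies_sons z (Is z).
Proof. by move=> s t zs zt E [_ idE]; exact: idE. Qed.

Lemma Is_finest z E : mfce E -> identifies_sons z E -> finer (Is z) E.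
Proof. by move=> mE iE x y xy; exact: xy. Qed.

Lemma Sis_mfce x : mfce (Sis x).
Proof. by apply: mfce_join_mfce => _ [z _ <-]; exact: Is_mfce. Qed.

End Supertropical.

Arguments ghosts {U}.
Arguments tangibles {U}.

(* Main.v *)
Require Import Defs.
From mathcomp Require Import all_boot all_algebra.
From mathcomp Require Import boolp classical_sets.
From Stdlib Require Import RelationClasses.

(** If [(uvz, a)] is an elementary step from a tangible son of [x] over
  [a = ex], then [x ~ uvz ~ uwz = a], because [x] and [uvz] are both sons of
  [x] over [ex]. Conversely, if no elementary step leads from a tangible son
  over [a] to [a], then every step starting in [S_a(x)] stays in [S_a(x)]. So
  the syntactic congruence of [S_a(x)], intersected with the fibre relation,
  is an MFCE-relation coarser than [Sis x], and it separates [x] from [a]. *)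

Set Implicit Arguments.
Unset Strict Implicit.
Unset Printing Implicit Defensive.

Import GRing.Theory.
Local Open Scope classical_set_scope.
Local Open Scope ring_scope.

Section Supertropical.
Variable U : comPzSemiRingType.
Implicit Types (x y z u v a c : U) (R : set U).

Lemma ghosts_mull u y : ghosts y -> ghosts (u * y).
Proof. by move=> [v _ <-]; exists (u * v) => //; rewrite mulrCA. Qed.

Lemma tangibles_mulr u y : tangibles (u * y) -> tangibles y.
Proof. by move=> tuy gy; apply/tuy/ghosts_mull. Qed.

Lemma ghosts_e y : ghosts (\e * y).
Proof. by exists y. Qed.

Lemma sons_refl x : tangibles x -> sons x x.
Proof. by move=> tx; split=> //; exists 1; rewrite ?mul1r. Qed.

Lemma sons_mul x u z : sons x z -> tangibles (u * z) -> sons x (u * z).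
Proof. by move=> [[p _ <-] _] tuz; split=> //; exists (u * p); rewrite ?mulrA. Qed.

Lemma sons_tangible_mul u z : tangibles (u * z) -> sons z (u * z).
Proof. by split=> //; exists u. Qed.

(** The coarsest MFCE-relation for which [R] is a union of classes. *)
Definition syntactic R y y' : Prop :=
  \e * y = \e * y' /\ forall u, R (u * y) <-> R (u * y').

(** A factor [z] on both sides is absorbed into the test multiplier, which becomes [u * z]. *)
Lemma syntactic_mfce R : mfce (syntactic R).
Proof.
split=> [|y y' z [eyy' Ryy']|y y' []//].
  split=> [y|y y' [eyy' Ryy']|y1 y2 y3 [e12 R12] [e23 R23]].
  - by split=> // u.
  - by split=> // u; split=> [/Ryy'|/Ryy'].
  - by split=> [|u]; [rewrite e12|rewrite R12].
split=> [|u]; first by rewrite !mulrA eyy'.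
by rewrite ![_ * z]mulrC !mulrA.
Qed.

Lemma Sis_finest x E :
  mfce E -> (forall z, sons x z -> identifies_sons z E) -> finer (Sis x) E.
Proof.
move=> mE iE; apply: mfce_join_least => // _ [z xz <-].
exact: Is_finest (iE z xz).
Qed.

Lemma Sis_identifies x z : sons x z -> identifies_sons z (Sis x).
Proof.
move=> xz s t zs zt; apply: (@mfce_join_ub _ _ (Is z)); first by exists z.
exact: Is_identifies.
Qed.

Hypothesis hU : supertropical U.

Lemma mulee : \e * \e = \e :> U.
Proof.
by rewrite -[RHS](supertropical_idem hU) {1}/ghost_one mulrDl mul1r.
Qed.

Lemma ghost_fixed y : ghosts y -> \e * y = y.
Proof. by move=> [u _ <-]; rewrite mulrA mulee. Qed.

(** The fibre condition leaves only one candidate: a ghost [b] related to [x] satisfies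
    [b = \e * b = \e * x]. *)
Lemma ghost_class_eqclass E x :
  mfce E -> ghost_class E (eqclass E x) <-> E x (\e * x).
Proof.
move=> [eqE mulE fibE]; split=> [[b gb xb]|xex].
  have Exb : E x b by change (eqclass E x b); rewrite xb; exact: reflexivity.
  by rewrite (fibE _ _ Exb) ghost_fixed.
exists (\e * x); first exact: ghosts_e.
apply/seteqP; split=> y /= Ey; first by transitivity x => //; symmetry.
by transitivity (\e * x).
Qed.

End Supertropical.

Theorem theorem7p16 (U : comPzSemiRingType) (hU : supertropical U)
    (x : U) (hx : tangibles x) (a : U) (ha : a = \e * x) :
  [<-> (* (i) *)
       ghost_class (Sis x) (eqclass (Sis x) x);
       (* (ii) *)
       exists z u v w : U,
         [/\ sons x z,
             elementary_Is_path z (PathTriple (v * z) u (w * z)),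
             sons_over a z (u * v * z)
           & runs_from_to (PathTriple (v * z) u (w * z)) (u * v * z) a];
       (* (iii) *)
       exists u v w p : U,
         [/\ \e * p * x = \e * v * p * x /\ \e * v * p * x = \e * w * p * x,
             \e * u * v * p * x = a,
             tangibles (u * v * p * x),
             tangibles (w * p * x)
           & u * w * p * x = a]].
Proof.
have ghost_a : ghosts a by rewrite ha; exact: ghosts_e.
tfae.
- move=> /(ghost_class_eqclass hU _ (Sis_mfce x)); rewrite -ha => xa.
  apply: contrapT => no_path.
  have step z s t u : sons x z -> sons_over (\e * z) z s ->
      sons_over (\e * z) z t ->
      sons_over a x (u * s) -> sons_over a x (u * t).
    move=> xz zs zt [[_ tus] eus].
    have eut : \e * (u * t) = a by rewrite mulrCA zt.2 -zs.2 mulrCA.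
    move: (zs) (zt) => [[[v _ vz] ts] es] [[[w _ wz] tt] et].
    (* If [u * t] were ghost, it would equal [\e * (u * t) = a], and [(s, u, t)] would be a path
       excluded by [no_path]. *)
    split=> //; rewrite -wz mulrA; apply: sons_mul => // gut.
    apply: no_path; exists z, u, v, w; split=> //.
    + by rewrite /elementary_Is_path /= vz wz.
    + rewrite -mulrA vz; split=> //; rewrite -vz mulrA.
      by apply: sons_tangible_mul; rewrite -mulrA vz.
    + split=> /=; first by rewrite mulrA.
      by rewrite -eut -wz ghost_fixed // mulrA.
  have : syntactic (sons_over a x) x a.
    apply: (@Sis_finest _ x) xa; first exact: syntactic_mfce.
    move=> z xz s t zs zt; split=> [|u]; first by rewrite zs.2 zt.2.
    (* The hypotheses of [step] on [s] and [t] are symmetric, so it gives both implications. *)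
    by split; apply: step; eassumption.
  (* The multiplier [1] carries membership in [sons_over a x] from [x] to [a], which is impossible
     since [a] is ghost. *)
  move=> [_ /(_ 1)]; rewrite !mul1r => -[+ _].
  by case=> [|[_ /(_ ghost_a)]//]; split; [exact: sons_refl|].
- move=> [_ [u [v [w [[[p _ <-] _] [zv zw] [[_ tuv] euv] [_ /= uw]]]]]].
  exists u, v, w, p; rewrite -!mulrA in tuv euv zv zw uw *; split=> //.
  + by rewrite zv.2 zw.2.
  + by case: zw => -[].
- move=> [u [v [w [p [[epv evw] euv tuv tw uw]]]]].
  rewrite -!mulrA in epv evw euv tuv tw uw.
  apply/(ghost_class_eqclass hU _ (Sis_mfce x)); rewrite -ha.
  (* Condition (iii) does not list [v * (p * x)] and [p * x] as tangible; both are factors of a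
     tangible product, and the ghosts form an ideal. *)
  have tv := tangibles_mulr tuv.
  have [Seq Smul _] := Sis_mfce x.
  transitivity (u * (v * (p * x))).
    apply: (@Sis_identifies _ x x); first exact: sons_refl.
      by split; [exact: sons_refl|].
    split; last by rewrite -ha.
    by rewrite !mulrA in tuv *; exact: sons_tangible_mul.
  (* With [z = p * x], the elements [v * z] and [w * z] are sons of [z] over [\e * z]; multiplying
     by [u] gives the second link. *)
  rewrite -uw ![u * _]mulrC; apply: Smul; apply: (@Sis_identifies _ x (p * x)).
  + exact/sons_tangible_mul/tangibles_mulr/tv.
  + by split; [exact: sons_tangible_mul|].
  + by split; [exact: sons_tangible_mul|rewrite -evw].
Qed.
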